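(* Let $p,q$ be positive integers with $p\le q$ and $n=p+q$. For every $G\in\mathscr{U}_n^{p,q}$, $$\operatorname{per} L(G)\ge 20(p-1)(q-1)+4n,$$ with equality if and only if $G\cong B(p,q)$.
   Context: For a simple graph $G$, $L(G)=D(G)-A(G)$ is its Laplacian matrix ($D(G)$ the diagonal degree matrix, $A(G)$ the adjacency matrix), and $\operatorname{per} X=\sum_{\sigma\in S_n}\prod_{t=1}^n x_{t\sigma(t)}$ is the permanent. A unicyclic graph is a connected graph with the same number of vertices and edges. A connected graph has a $(p,q)$-bipartition if its vertex set splits into parts of sizes $p$ and $q$ with every edge joining the two parts; $\mathscr{U}_n^{p,q}$ is the set of bipartite unicyclic graphs on $n=p+q$ vertices with a $(p,q)$-bipartition ($p\le q$). $B(p,q)$ is the graph obtained from the 4-cycle $v_1v_2v_3v_4v_1$ by attaching $p-2$ pendant vertices at $v_1$ and $q-2$ pendant vertices at $v_2$. *)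

(* Defs.v *)
From mathcomp Require Import all_boot all_order all_algebra.
From mathcomp Require Import perm.
Set Implicit Arguments. Unset Strict Implicit. Unset Printing Implicit Defensive.
Import GRing.Theory Num.Theory.
Local Open Scope ring_scope.

Definition simple_graph (V : finType) (e : rel V) : Prop :=
  symmetric e /\ irreflexive e.

Definition graph_connected (V : finType) (e : rel V) : Prop :=
  forall x y : V, connect e x y.

Definition edge_set (V : finType) (e : rel V) : {set {set V}} :=
  [set E : {set V} | [exists x : V, exists y : V, e x y && (E == [set x; y])]].

Definition unicyclic (V : finType) (e : rel V) : Prop :=
  simple_graph e /\ graph_connected e /\ #|edge_set e| = #|V|.

Definition has_bipartition (V : finType) (e : rel V) (p q : nat) : Prop :=
  exists A : {set V}, [/\ #|A| = p, #|~: A| = q &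
    forall x y, e x y -> (x \in A) != (y \in A)].

Definition in_U (p q : nat) (e : rel 'I_(p + q)) : Prop :=
  unicyclic e /\ has_bipartition e p q.

Definition degree (V : finType) (e : rel V) (x : V) : nat := #|[set y | e x y]|.

Definition laplacian (n : nat) (e : rel 'I_n) : 'M[int]_n :=
  \matrix_(i, j) ((i == j)%:R * (degree e i)%:R - (e i j)%:R).

Definition per (R : comPzRingType) (n : nat) (A : 'M[R]_n) : R :=
  \sum_(s : 'S_n) \prod_(i < n) A i (s i).

(* B(p,q) on vertices 0..p+q-1: 4-cycle 0-1-2-3-0 (v1..v4 = 0..3),
   pendant vertices 4..p+1 attached to 0 (p-2 of them) and
   vertices p+2..p+q-1 attached to 1 (q-2 of them). *)
Definition B_base (p : nat) (i j : nat) : bool :=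
  [|| (i == 0%N) && (j == 1%N), (i == 1%N) && (j == 2%N),
      (i == 2%N) && (j == 3%N), (i == 3%N) && (j == 0%N),
      (i == 0%N) && (4 <= j < p + 2)%N
    | (i == 1%N) && (4 <= j)%N && (p + 2 <= j)%N].

Definition Bgraph (p q : nat) : rel 'I_(p + q) :=
  fun i j => B_base p i j || B_base p j i.

Definition graph_iso (n : nat) (e1 e2 : rel 'I_n) : Prop :=
  exists f : 'S_n, forall x y, e1 x y = e2 (f x) (f y).

Arguments Bgraph : clear implicits.
Arguments in_U : clear implicits.

(* Main.v *)
(** The two sides of a bipartite graph carry a sign matrix conjugating the
    Laplacian into the nonnegative matrix D + A, so per L is a sum of
    nonnegative terms, and deleting a pendant vertex u with neighbour w gives
    per L(G) = per L(G-u) + 2 per L(G-u)(w), where L(H)(w) is L(H) with the row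
    and column of w removed.  One proves simultaneously, by induction on leaves,
    that per L(G) >= 20(p-1)(q-1) + 4(p+q), that per L(G)(x) >= 10s - 8 when x
    lies on the side of size s, and that per L(G)(x,y) >= 5 for x, y on opposite
    sides.  Call x dominating if it is adjacent to the whole opposite side.
    Equality holds in the third bound iff x and y are dominating, in the second
    iff x and some vertex opposite to it are, in the first iff some two opposite
    vertices are.  A unicyclic graph without leaves is 2-regular: it is the
    4-cycle, or has at least 6 vertices and then crude bounds are strict.  A
    unicyclic graph with such a pair is a spanning double star plus one edge,
    which is B(p,q). *)
Require Import Defs.
From mathcomp Require Import all_boot all_order all_algebra.
From mathcomp Require Import perm.
From mathcomp Require Import zify.
Set Implicit Arguments. Unset Strict Implicit. Unset Printing Implicit Defensive.
Import GRing.Theory Num.Theory.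

(** * Permanents of principal submatrices *)

(** The permanent of the principal submatrix on [T]. Taking permutations of all of [V] that fix the
    complement of [T] lets rows and columns be deleted without changing the index type. *)
Definition perm_sum (V : finType) (a : V -> V -> nat) (T : {set V}) : nat :=
  \sum_(s : {perm V} | perm_on T s) \prod_(i in T) a i (s i).

Lemma eq_perm_sum (V : finType) (a b : V -> V -> nat) (T : {set V}) :
  {in T &, a =2 b} -> perm_sum a T = perm_sum b T.
Proof.
move=> eab; apply: eq_bigr => s sT; apply: eq_bigr => i iT.
by apply: eab; rewrite ?perm_closed.
Qed.

Lemma perm_sum0 (V : finType) (a : V -> V -> nat) : perm_sum a set0 = 1.
Proof.
rewrite /perm_sum (big_pred1 (1%g : {perm V})) ?big_set0 // => s /=.
apply/idP/eqP => [s0 | ->]; last by rewrite perm_on1.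
by apply/permP => i; rewrite perm1 (out_perm s0) ?inE.
Qed.

(** Expansion along row [x]. The minor without row [x] and column [y] is not principal; [tperm x y]
    relabels its columns so that rows and columns are again both indexed by [T :\ x]. *)
Lemma perm_sum_expand (V : finType) (a : V -> V -> nat) (T : {set V}) (x : V) :
  x \in T ->
  perm_sum a T =
  \sum_(y in T) a x y * perm_sum (fun i j => a i (tperm x y j)) (T :\ x).
Proof.
move=> xT.
rewrite /perm_sum (partition_big (fun s : {perm V} => s x) (mem T)) /=; last first.
  by move=> s sT; rewrite perm_closed.
apply: eq_bigr => y yT.
have tT: perm_on T (tperm x y).
  by apply/subsetP => z; rewrite inE; case: tpermP => [->|->|]; rewrite ?eqxx.
(* After composing with [tperm x y], sending [x] to [y] becomes fixing [x]. *)
rewrite big_distrr /= (reindex_inj (mulIg (tperm x y))) /=.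
apply: eq_big => [s | s].
  rewrite permM -(inj_eq (@perm_inj _ (tperm x y))) tpermK tpermR.
  apply/andP/idP => [[sT /eqP sx] | sT].
    apply/subsetP => z; rewrite !inE => sz.
    have zx : z != x by apply: contraNneq sz => ->; rewrite sx.
    rewrite zx /=.
    have : perm_on T (s * tperm x y * tperm x y)%g by apply: perm_onM.
    by rewrite -mulgA tperm2 mulg1 => /subsetP; apply; rewrite inE.
  split; last by rewrite (out_perm sT) // !inE eqxx.
  apply: perm_onM => //; apply: subset_trans sT _; exact: subD1set.
case/andP => _ /eqP sx.
rewrite (big_setD1 x) //= sx; congr (_ * _).
by apply: eq_bigr => i _; rewrite permM.
Qed.

Lemma perm_sum_isolated (V : finType) (a : V -> V -> nat) (T : {set V}) (u : V) :
  u \in T -> (forall y, y \in T -> y != u -> a u y = 0) ->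
  perm_sum a T = a u u * perm_sum a (T :\ u).
Proof.
move=> uT a0; rewrite (perm_sum_expand _ uT) (big_setD1 u) //= big1 => [|y]; last first.
  by rewrite !inE => /andP[yu yT]; rewrite a0.
by rewrite addn0; congr (_ * _); apply: eq_perm_sum => i j _ _; rewrite tperm1 perm1.
Qed.

(** A permutation moving [u] picks a zero of column [u], in the row of the preimage of [u]. The
    column form serves minors that are left after expanding along the row of a pendant vertex, where
    only a column of zeros survives. *)
Lemma perm_sum_isolated_col (V : finType) (a : V -> V -> nat) (T : {set V}) (u : V) :
  u \in T -> (forall y, y \in T -> y != u -> a y u = 0) ->
  perm_sum a T = a u u * perm_sum a (T :\ u).
Proof.
move=> uT a0.
rewrite /perm_sum (bigID (fun s : {perm V} => s u == u)) /=.
rewrite [X in _ + X]big1 ?addn0 => [|s /andP[sT su]]; last first.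
  have sT' : perm_on T (s^-1)%g by apply: perm_onV.
  have sV : s ((s^-1)%g u) = u by rewrite permKV.
  rewrite (big_setD1 ((s^-1)%g u)) /= ?perm_closed // sV a0 ?mul0n ?perm_closed //.
  by apply: contraNneq su => E; rewrite -{1}E sV.
rewrite big_distrr /=; apply: eq_big => [s | s /andP[sT /eqP su]].
  apply/andP/idP => [[sT /eqP su]|sT].
    apply/subsetP => z; rewrite !inE => sz.
    have -> /= : z != u by apply: contraNneq sz => ->; rewrite su.
    by apply: (subsetP sT); rewrite inE.
  split; last by rewrite (out_perm sT) // !inE eqxx.
  apply: subset_trans sT _; exact: subD1set.
by rewrite (big_setD1 u) //= su.
Qed.

(** A contributing permutation fixes [u] or swaps it with [w]: if it sends [u] to [w], the preimage
    of [u] can only be [w]. *)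
Lemma perm_sum_pendant (V : finType) (a : V -> V -> nat) (T : {set V}) (u w : V) :
  u \in T -> w \in T -> w != u ->
  (forall y, y \in T -> y != u -> y != w -> a u y = 0 /\ a y u = 0) ->
  perm_sum a T =
  a u u * perm_sum a (T :\ u) + a u w * a w u * perm_sum a (T :\ u :\ w).
Proof.
move=> uT wT wu a0; rewrite (perm_sum_expand _ uT) (big_setD1 u) //=.
rewrite (big_setD1 w) ?inE ?wu //= big1 => [|y]; last first.
  by rewrite !inE => /and3P[yw yu yT]; have [->] := a0 _ yT yu yw.
rewrite addn0; congr (_ * _ + _).
  by apply: eq_perm_sum => i j _ _; rewrite tperm1 perm1.
rewrite (@perm_sum_isolated_col _ _ _ w) ?inE ?wu //; last first.
  by move=> y; rewrite !inE => /andP[yu yT] yw; rewrite tpermR; have [] := a0 _ yT yu yw.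
rewrite tpermR mulnA; congr (_ * _); apply: eq_perm_sum => i j _.
by rewrite !inE => /and3P[jw ju jT]; rewrite tpermD // eq_sym.
Qed.

Lemma perm_sum_diag_le (V : finType) (a : V -> V -> nat) (T : {set V}) (x : V) :
  x \in T -> a x x * perm_sum a (T :\ x) <= perm_sum a T.
Proof.
move=> xT; rewrite (perm_sum_expand _ xT) (big_setD1 x) //=.
suff -> : perm_sum (fun i j => a i (tperm x x j)) (T :\ x) = perm_sum a (T :\ x).
  exact: leq_addr.
by apply: eq_perm_sum => i j _ _; rewrite tperm1 perm1.
Qed.

(** Only the permutations that fix [x], or swap it with some [y], are kept; the dropped terms are
    nonnegative. *)
Lemma perm_sum_matching_le (V : finType) (a : V -> V -> nat) (T : {set V}) (x : V) :
  x \in T ->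
  a x x * perm_sum a (T :\ x)
    + \sum_(y in T :\ x) a x y * a y x * perm_sum a (T :\ x :\ y)
  <= perm_sum a T.
Proof.
move=> xT; rewrite (perm_sum_expand _ xT) [X in _ <= X](big_setD1 x) //=.
apply: leq_add.
  by rewrite leq_mul2l (@eq_perm_sum _ _ a) ?leqnn ?orbT // => i j _ _; rewrite tperm1 perm1.
apply: leq_sum => y yT; rewrite -mulnA leq_mul2l; apply/orP; right.
apply: leq_trans (perm_sum_diag_le _ yT); rewrite tpermR leq_mul2l.
apply/orP; right; rewrite (@eq_perm_sum _ _ a) // => i j _.
by rewrite !inE => /and3P[jy jx _]; rewrite tpermD // eq_sym.
Qed.

Lemma perm_sum_prod_le (V : finType) (a : V -> V -> nat) (T : {set V}) :
  \prod_(i in T) a i i <= perm_sum a T.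
Proof.
rewrite /perm_sum (bigD1 (1%g : {perm V})) ?perm_on1 //=.
by under eq_bigr => i _ do rewrite -{2}(perm1 i); exact: leq_addr.
Qed.

(** Linearity of the permanent in row [w]. It accounts for the unit that a pendant neighbour adds to
    the degree of [w]. *)
Lemma perm_sum_incr_diag (V : finType) (a b : V -> V -> nat) (T : {set V}) (w : V) :
  w \in T -> b w w = (a w w).+1 ->
  (forall i j, i \in T -> (i != w) || (j != w) -> b i j = a i j) ->
  perm_sum b T = perm_sum a T + perm_sum a (T :\ w).
Proof.
move=> wT bw bE; rewrite !(perm_sum_expand _ wT) !(big_setD1 w wT) /=.
have Eb : perm_sum (fun i j => b i (tperm w w j)) (T :\ w) = perm_sum a (T :\ w).
  by apply: eq_perm_sum => i j; rewrite !inE tperm1 perm1 => /andP[iw iT] _; rewrite bE ?iw.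
have Ea : perm_sum (fun i j => a i (tperm w w j)) (T :\ w) = perm_sum a (T :\ w).
  by apply: eq_perm_sum => i j _ _; rewrite tperm1 perm1.
have ES : \sum_(y in T :\ w) b w y * perm_sum (fun i j => b i (tperm w y j)) (T :\ w)
        = \sum_(y in T :\ w) a w y * perm_sum (fun i j => a i (tperm w y j)) (T :\ w).
  apply: eq_bigr => y; rewrite !inE => /andP[yw yT]; rewrite bE ?yw ?orbT //.
  congr (_ * _); apply: eq_perm_sum => i j; rewrite !inE => /andP[iw iT] _.
  by rewrite bE ?iw.
by rewrite Eb Ea ES bw mulSn -addnA addnC.
Qed.

Lemma perm_sum2 (V : finType) (a : V -> V -> nat) (x y : V) : x != y ->
  perm_sum a [set x; y] = a x x * a y y + a x y * a y x.
Proof.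
move=> xy; have yx : y != x by rewrite eq_sym.
have D : [set x; y] :\ x = [set y].
  by apply/setP => z; rewrite !inE; case: (eqVneq z x) => [->|]; rewrite ?(negbTE xy).
have E b : perm_sum b [set y] = b y y.
  rewrite (@perm_sum_expand _ _ _ y) ?inE // big_set1.
  by rewrite setDv perm_sum0 muln1.
rewrite (@perm_sum_expand _ _ _ x) ?inE ?eqxx // D big_setU1 ?inE //= big_set1 !E.
by rewrite tperm1 perm1 tpermR.
Qed.

Lemma perm_sum3 (V : finType) (a : V -> V -> nat) (x y z : V) :
  x != y -> x != z -> y != z ->
  perm_sum a [set x; y; z] =
    a x x * (a y y * a z z + a y z * a z y)
  + a x y * (a y x * a z z + a y z * a z x)
  + a x z * (a y y * a z x + a y x * a z y).
Proof.
move=> xy xz yz; have [yx zx zy] : [/\ y != x, z != x & z != y] by rewrite ![_ == x]eq_sym [z == y]eq_sym.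
have D : [set x; y; z] :\ x = [set y; z].
  apply/setP => t; rewrite !inE; case: (eqVneq t x) => [->|] //=.
  by rewrite (negbTE xy) (negbTE xz).
rewrite (@perm_sum_expand _ _ _ x) ?inE ?eqxx // D.
rewrite -setUA big_setU1 ?inE ?negb_or ?xy //= big_setU1 ?inE //= big_set1 !perm_sum2 //.
by rewrite tperm1 !perm1 !tpermR !tpermD // addnA.
Qed.

(** * Laplacian permanents and deletion of a leaf *)

Definition sub_degree (V : finType) (e : rel V) (S : {set V}) (x : V) : nat :=
  #|[set z in S | e x z]|.

(* For bipartite [e], conjugating by the diagonal matrix of signs of the two
   sides turns the Laplacian of the subgraph induced by [S] into this matrix. *)
Definition signless (V : finType) (e : rel V) (S : {set V}) (i j : V) : nat :=
  if i == j then sub_degree e S i else e i j.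

(** [S] carries the graph and fixes the degrees, [T] selects the rows and columns kept. Thus
    [lap_per e S (S :\ x)] is per L(G)(x) for the graph G induced by [S]: a vertex missing from [T]
    alone still counts in the degrees. *)
Definition lap_per (V : finType) (e : rel V) (S T : {set V}) : nat :=
  perm_sum (signless e S) T.

Definition two_colored (V : finType) (e : rel V) (A : {set V}) : Prop :=
  symmetric e /\ forall x y, e x y -> (x \in A) != (y \in A).

Definition leaf (V : finType) (e : rel V) (S : {set V}) (u w : V) : Prop :=
  [/\ u \in S, w \in S, e u w & forall z, z \in S -> e u z -> z = w].

Lemma two_colored_irr (V : finType) (e : rel V) (A : {set V}) :
  two_colored e A -> irreflexive e.
Proof. by case=> _ eA x; apply/negP => /eA; rewrite eqxx. Qed.

Lemma leaf_degree (V : finType) (e : rel V) (S : {set V}) (u w : V) :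
  leaf e S u w -> sub_degree e S u = 1.
Proof.
case=> uS wS uw uz; rewrite /sub_degree (_ : [set _ in _ | _] = [set w]) ?cards1 //.
apply/setP => z; rewrite !inE; apply/andP/eqP => [[]|->] //; exact: uz.
Qed.

Lemma degree1_leaf (V : finType) (e : rel V) (S : {set V}) (u : V) :
  u \in S -> sub_degree e S u = 1 -> exists w, leaf e S u w.
Proof.
move=> uS /eqP /cards1P[w /setP E]; exists w.
have := E w; rewrite !inE eqxx => /andP[wS uw]; split=> // z zS uz.
by have := E z; rewrite !inE zS uz => /esym/eqP.
Qed.

Lemma sub_degreeD1 (V : finType) (e : rel V) (S : {set V}) (u x : V) :
  u \in S -> sub_degree e S x = sub_degree e (S :\ u) x + e x u.
Proof.
move=> uS; rewrite /sub_degree (cardsD1 u) !inE uS addnC /=; congr (#|pred_of_set _| + _).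
by apply/setP => z; rewrite !inE andbA.
Qed.

Lemma leaf_adj (V : finType) (e : rel V) (A S : {set V}) (u w x : V) :
  two_colored e A -> leaf e S u w -> x \in S -> e x u = (x == w).
Proof.
move=> [eC eA] [uS wS uw uz] xS; apply/idP/eqP => [|->]; rewrite eC //.
exact: uz.
Qed.

Lemma leaf_neq (V : finType) (e : rel V) (A S : {set V}) (u w : V) :
  two_colored e A -> leaf e S u w -> w != u.
Proof. by move=> eA [_ _ uw _]; apply: contraTneq uw => ->; rewrite (two_colored_irr eA). Qed.

(** With row [u] absent, the only trace of the leaf is one unit in the degree of [w]. *)
Lemma lap_per_leaf_out (V : finType) (e : rel V) (A S T : {set V}) (u w : V) :
  two_colored e A -> leaf e S u w -> T \subset S -> u \notin T ->
  lap_per e S T = lap_per e (S :\ u) T + (w \in T) * lap_per e (S :\ u) (T :\ w).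
Proof.
move=> eA lf /subsetP TS uT; have [uS wS uw uz] := lf.
have E i j : i \in T -> (i != w) || (j != w) ->
    signless e S i j = signless e (S :\ u) i j.
  move=> iT; rewrite /signless; case: (eqVneq i j) => // <-; rewrite orbb => iw.
  by rewrite (@sub_degreeD1 _ _ _ u) // (leaf_adj eA lf) ?TS // (negbTE iw) addn0.
case: (boolP (w \in T)) => wT; last first.
  rewrite addn0; apply: eq_perm_sum => i j iT jT; apply: E => //.
  by apply/orP; left; apply: contraNneq wT => <-.
rewrite mul1n; apply: perm_sum_incr_diag => //.
by rewrite /signless eqxx (@sub_degreeD1 _ _ _ u) // (leaf_adj eA lf) // eqxx addn1.
Qed.

(** The factor 2 has two sources: one minor without [w] comes from swapping [u] and [w], the other
    from the unit that [u] contributes to the degree of [w] when [u] is fixed. *)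
Lemma lap_per_leaf_in (V : finType) (e : rel V) (A S T : {set V}) (u w : V) :
  two_colored e A -> leaf e S u w -> T \subset S -> u \in T ->
  lap_per e S T = lap_per e (S :\ u) (T :\ u)
                + (w \in T) * (2 * lap_per e (S :\ u) (T :\ u :\ w)).
Proof.
move=> eA lf /subsetP TS uT; have [uS wS uw uz] := lf; have wu := leaf_neq eA lf.
have eC := eA.1.
have duu : signless e S u u = 1 by rewrite /signless eqxx (leaf_degree lf).
have u0 y : y \in T -> y != u -> y != w -> signless e S u y = 0 /\ signless e S y u = 0.
  move=> yT yu yw; rewrite /signless eq_sym (negbTE yu) eC.
  by rewrite (leaf_adj eA lf) ?TS // (negbTE yw).
have TuS : T :\ u \subset S by apply/subsetP => z /setD1P[_ /TS].
have TuwS : T :\ u :\ w \subset S by apply/subsetP => z /setD1P[_ /setD1P[_ /TS]].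
case: (boolP (w \in T)) => wT.
  rewrite {1}/lap_per (perm_sum_pendant uT wT) // duu {2 3}/signless [u == w]eq_sym (negbTE wu).
  rewrite [e w u]eC uw !mul1n -!/(lap_per _ _ _).
  rewrite !(lap_per_leaf_out eA lf) ?inE ?eqxx ?andbF //= wu wT !mul1n mul0n.
  by rewrite mul2n -addnn !addn0 addnA.
rewrite {1}/lap_per (perm_sum_isolated uT) => [|y yT yu]; last first.
  by have [|->] := u0 y yT yu => //; apply: contraNneq wT => <-.
by rewrite duu mul1n -/(lap_per _ _ _) (lap_per_leaf_out eA lf) ?inE ?eqxx //= (negbTE wT) andbF.
Qed.

(** * Induced unicyclic subgraphs and their two sides *)

(** Connectivity of the subgraph induced by [S], phrased with cuts instead of paths, so that
    deleting a leaf only requires choosing a suitable cut. *)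
Definition cut_connected (V : finType) (e : rel V) (S : {set V}) : Prop :=
  forall C : {set V}, C \proper S -> C != set0 ->
  exists x y, [/\ x \in C, y \in S, y \notin C & e x y].

(* Edges are counted twice by the degree sum. *)
Definition unicyclic_on (V : finType) (e : rel V) (S : {set V}) : Prop :=
  [/\ S != set0, cut_connected e S & \sum_(x in S) sub_degree e S x = 2 * #|S|].

Definition side (V : finType) (A S : {set V}) (b : bool) : nat :=
  #|[set z in S | (z \in A) == b]|.

Definition dominating (V : finType) (e : rel V) (A S : {set V}) (x : V) : Prop :=
  forall z, z \in S -> (z \in A) != (x \in A) -> e x z.

(** The cut around [x] yields a neighbour; when [S] is a single vertex, the degree sum itself makes
    the degree 2. *)
Lemma unicyclic_on_degree_gt0 (V : finType) (e : rel V) (S : {set V}) (x : V) :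
  unicyclic_on e S -> x \in S -> 0 < sub_degree e S x.
Proof.
case=> S0 cS dS xS; have [Sx|Sx] := eqVneq S [set x].
  by move: dS; rewrite {1 3}Sx big_set1 cards1 => ->.
have [||y [z [/set1P -> zS _ yz]]] := cS [set x].
- by rewrite properEneq eq_sym Sx sub1set.
- by apply/set0Pn; exists x; rewrite inE.
by rewrite card_gt0; apply/set0Pn; exists z; rewrite inE zS.
Qed.

(** A cut of the smaller graph extends to [S] by putting [u] on the same side as [w], so the
    crossing edge avoids [u]. The degree sum loses one unit at [u] and one at [w]. *)
Lemma unicyclic_on_delete_leaf (V : finType) (e : rel V) (A S : {set V}) (u w : V) :
  two_colored e A -> leaf e S u w -> unicyclic_on e S -> unicyclic_on e (S :\ u).
Proof.
move=> eA lf [S0 cS dS]; have [uS wS uw uz] := lf; have wu := leaf_neq eA lf.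
have eC := eA.1.
split.
- by apply/set0Pn; exists w; rewrite !inE wu.
- move=> C CS C0; have uC : u \notin C.
    by apply/negP => /(subsetP (proper_sub CS)); rewrite !inE eqxx.
  have CsubS : C \subset S := subset_trans (proper_sub CS) (subD1set _ _).
  case: (boolP (w \in C)) => wC.
    have [||x [y [xC yS yC xy]]] := cS (u |: C).
    - have [_ [t /setD1P[tu tS] tC]] := properP CS; apply/properP; split.
        by rewrite subUset sub1set uS.
      by exists t; rewrite // !inE negb_or tu.
    - by apply/set0Pn; exists u; rewrite !inE eqxx.
    move: yC; rewrite !inE negb_or => /andP[yu yC]; exists x, y.
    case/setU1P: xC xy => [-> uy|xC xy]; last by split; rewrite ?inE ?yu.
    by rewrite (uz y) // wC in yC.
  have [||x [y [xC yS yC xy]]] := cS C => //.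
    by apply/properP; split => //; exists u.
  exists x, y; split => //; rewrite !inE yS andbT.
  apply: contraNneq wC => yu; rewrite -(uz x) //; first exact: (subsetP CsubS).
  by rewrite eC -yu.
- have : \sum_(x in S) sub_degree e S x = (\sum_(x in S :\ u) sub_degree e (S :\ u) x).+2.
    rewrite (big_setD1 u) //= (leaf_degree lf).
    under eq_bigr => x xS.
      rewrite (sub_degreeD1 _ _ uS) (leaf_adj eA lf) ?(subsetP (subD1set _ _) _ xS) //.
      over.
    rewrite big_split /= (big_setD1 w) /= ?inE ?wu // [X in _ + (_ + X)](big_setD1 w) /= ?inE ?wu //.
    rewrite eqxx [\sum_(i in _ :\ w) (nat_of_bool _)]big1 ?addn0; first by lia.
    by move=> i; rewrite !inE => /andP[/negbTE ->].
  rewrite dS (cardsD1 u S) uS; lia.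
Qed.

Lemma card_sides (V : finType) (A S : {set V}) (b : bool) :
  #|S| = side A S b + side A S (~~ b).
Proof.
rewrite -(cardsID [set z | (z \in A) == b] S) /side; congr (_ + _).
  by apply: eq_card => z; rewrite !inE.
by apply: eq_card => z; rewrite !inE andbC; case: (z \in A); case: b.
Qed.

Lemma sideD1 (V : finType) (A S : {set V}) (b : bool) (u : V) :
  u \in S -> side A S b = side A (S :\ u) b + ((u \in A) == b).
Proof.
move=> uS; rewrite /side (cardsD1 u) !inE uS addnC /=; congr (#|pred_of_set _| + _).
by apply/setP => z; rewrite !inE andbA.
Qed.

Lemma sub_degree_opposite (V : finType) (e : rel V) (A S : {set V}) (x : V) :
  two_colored e A -> sub_degree e S x = \sum_(y in S | (y \in A) != (x \in A)) e x y.
Proof.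
move=> [_ eA]; rewrite big_mkcond /= /sub_degree -sum1_card big_mkcond /=.
apply: eq_bigr => y _; rewrite !inE; case: (y \in S) => //=.
by case xy : (e x y); [rewrite eq_sym (eA _ _ xy) | case: ifP].
Qed.

(** Both sums count every edge once, at its end on the given side. *)
Lemma handshake_sides (V : finType) (e : rel V) (A S : {set V}) :
  two_colored e A ->
  \sum_(x in S | x \in A) sub_degree e S x = \sum_(x in S | x \notin A) sub_degree e S x.
Proof.
move=> eA; have eC := eA.1.
rewrite (eq_bigr (fun x => \sum_(y in S | y \notin A) e x y)) => [|x /andP[xS xA]]; last first.
  by rewrite (sub_degree_opposite _ _ eA) xA; apply: eq_bigl => y; case: (y \in A).
rewrite exchange_big /=; apply: eq_bigr => y /andP[yS yA].
rewrite (sub_degree_opposite _ _ eA) (negbTE yA).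
by apply: eq_big => x; [case: (x \in A) | rewrite eC].
Qed.

Lemma degree_le_side (V : finType) (e : rel V) (A S : {set V}) (x : V) :
  two_colored e A -> sub_degree e S x <= side A S (~~ (x \in A)).
Proof.
move=> [_ eA]; apply/subset_leq_card/subsetP => y; rewrite !inE => /andP[-> /eA].
by case: (x \in A); case: (y \in A).
Qed.

(** The neighbourhood is contained in the opposite side, so equal cardinality means equality of
    sets. *)
Lemma dominating_degree (V : finType) (e : rel V) (A S : {set V}) (x : V) :
  two_colored e A ->
  sub_degree e S x = side A S (~~ (x \in A)) <-> dominating e A S x.
Proof.
move=> eA; have sub : [set z in S | e x z] \subset [set z in S | (z \in A) == ~~ (x \in A)].
  apply/subsetP => y; rewrite !inE => /andP[-> /eA.2].
  by case: (x \in A); case: (y \in A).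
rewrite /sub_degree /side; split=> [/eqP|dom].
  rewrite (subset_leqif_cards sub).2 => /eqP/setP E z zS zx; have := E z.
  by rewrite !inE zS; case: (z \in A) zx; case: (x \in A) => //= _ ->.
apply: eq_card => z; rewrite !inE; case: (boolP (z \in S)) => //= zS.
apply/idP/eqP => [/eA.2|E]; first by case: (x \in A); case: (z \in A).
by apply: dom => //; rewrite E; case: (x \in A).
Qed.

(** * The 4-cycle and crude lower bounds *)

(** The 4-cycle attains all three bounds: 36 = 20 * 1 * 1 + 4 * 4, 12 = 10 * 2 - 8, and 5. *)
Lemma lap_per_C4 (V : finType) (e : rel V) (A : {set V}) (x x' y y' : V) :
  two_colored e A -> let S := [set x; x'; y; y'] in
  [&& x != x', y != y', (x' \in A) == (x \in A), (y' \in A) == (y \in A)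
    & (x \in A) != (y \in A)] ->
  [&& e x y, e x y', e x' y & e x' y'] ->
  [/\ lap_per e S S = 36, lap_per e S (S :\ x) = 12 & lap_per e S (S :\ x :\ y) = 5].
Proof.
move=> eA S /and5P[xx yy /eqP cx /eqP cy cxy] /and4P[exy exy' ex'y ex'y'].
have eC := eA.1.
have neq a b : (a \in A) != (b \in A) -> a != b by apply: contraNneq => ->.
have N : [/\ x != y, x != y', x' != y & x' != y'].
  by split; apply: neq; rewrite ?cx ?cy.
have [xy xy' x'y x'y'] := N.
have nxx' : e x x' = false by apply/negP => /eA.2; rewrite cx eqxx.
have nyy' : e y y' = false by apply/negP => /eA.2; rewrite cy eqxx.
have nx'x : e x' x = false by rewrite eC. have ny'y : e y' y = false by rewrite eC.
have [eyx ey'x eyx' ey'x'] : [/\ e y x, e y' x, e y x' & e y' x'] by split; rewrite eC.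
pose eE := (two_colored_irr eA, (exy, exy', ex'y, ex'y'), (eyx, ey'x, eyx', ey'x'),
            (nxx', nyy', nx'x, ny'y)).
have x'x : x' != x by rewrite eq_sym. have y'y : y' != y by rewrite eq_sym.
have yx : y != x by rewrite eq_sym. have y'x : y' != x by rewrite eq_sym.
have yx' : y != x' by rewrite eq_sym. have y'x' : y' != x' by rewrite eq_sym.
have E : S =i [:: x; x'; y; y'] by move=> z; rewrite !inE !orbA.
have U : uniq [:: x; x'; y; y'] by rewrite /= !inE !negb_or xx xy xy' x'y x'y' yy.
have deg z : sub_degree e S z = e z x + e z x' + e z y + e z y'.
  rewrite /sub_degree -sum1_card big_mkcond (eq_bigr (fun t => if t \in S then e z t : nat else 0)) => [|t _].
    rewrite -big_mkcond (eq_bigl _ _ E) -big_uniq //=.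
    by rewrite !big_cons big_nil addn0 !addnA.
  by rewrite !inE; case: (_ || _) => //=; case: (e z t).
have [dx dx' dy dy'] : [/\ signless e S x x = 2, signless e S x' x' = 2, signless e S y y = 2
    & signless e S y' y' = 2].
  by rewrite /signless !eqxx !deg !eE.
have O i j : i != j -> signless e S i j = e i j by rewrite /signless => /negbTE ->.
have Sx : S :\ x = [set x'; y; y'].
  by apply/setP => z; rewrite !inE; case: (eqVneq z x) => [->|//]; rewrite !(negbTE xx, negbTE xy, negbTE xy').
have Sxy : S :\ x :\ y = [set x'; y'].
  by rewrite Sx; apply/setP => z; rewrite !inE; case: (eqVneq z y) => [->|//]; rewrite ?(negbTE yx', negbTE yy) ?orbF.
have xS : x \in S by rewrite !inE eqxx.
split.
- rewrite /lap_per (perm_sum_expand _ xS) (eq_bigl _ _ E) -big_uniq //=.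
  rewrite !big_cons big_nil Sx !perm_sum3 //.
  by rewrite !tperm1 !perm1 !tpermR !tpermD // dx dx' dy dy' !O // !eE.
- by rewrite Sx /lap_per perm_sum3 // dx' dy dy' !O // !eE.
- by rewrite Sxy /lap_per perm_sum2 // dx' dy' !O // !eE.
Qed.

(** Only the identity permutation is kept, whose term is a product of degrees. *)
Lemma leq_lap_per_prod (V : finType) (e : rel V) (S T : {set V}) (d : nat) :
  {in T, forall x, d <= sub_degree e S x} -> d ^ #|T| <= lap_per e S T.
Proof.
move=> dT; apply: leq_trans (perm_sum_prod_le _ _).
rewrite -prod_nat_const; apply: leq_prod => i iT.
by rewrite /signless eqxx dT.
Qed.

Lemma lap_per_gt0 (V : finType) (e : rel V) (S T : {set V}) :
  unicyclic_on e S -> T \subset S -> 0 < lap_per e S T.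
Proof.
move=> uS /subsetP TS; rewrite -(exp1n #|T|); apply: leq_lap_per_prod => x xT.
by apply: unicyclic_on_degree_gt0 => //; apply: TS.
Qed.

Lemma lap_per_row_ge (V : finType) (e : rel V) (A S T : {set V}) (x : V) :
  two_colored e A -> x \in T ->
  sub_degree e S x * lap_per e S (T :\ x) + \sum_(y in T | e x y) lap_per e S (T :\ x :\ y)
  <= lap_per e S T.
Proof.
move=> eA xT; apply: leq_trans (perm_sum_matching_le _ xT).
rewrite {1}/signless eqxx leq_add2l [X in _ <= X]big_mkcond [X in X <= _]big_mkcond /=.
apply: leq_sum => y _; rewrite !inE; case: ifP => // /andP[yT xy].
have yx : y != x by apply: contraTneq xy => ->; rewrite (two_colored_irr eA).
by rewrite yx yT /signless eq_sym (negbTE yx) [e y x]eA.1 xy !mul1n.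
Qed.

(** * The three bounds and the 2-regular case *)

(** The truncated predecessors are harmless: in the bounds below both sides have at least two
    vertices. *)
Definition extremal_per (p q : nat) : nat := 20 * p.-1 * q.-1 + 4 * (p + q).

Definition dominating_pair (V : finType) (e : rel V) (A S : {set V}) (x y : V) : Prop :=
  [/\ x \in S, y \in S, (x \in A) != (y \in A), dominating e A S x & dominating e A S y].

(* The bounds on the permanents with one or two vertices removed are what makes
   the induction on leaves work. *)
Record lap_per_bounds (V : finType) (e : rel V) (A S : {set V}) : Prop := LapPerBounds {
  sides_ge2 : forall b, 2 <= side A S b;
  lap_per_ge : extremal_per (side A S true) (side A S false) <= lap_per e S S;
  lap_per_eq : lap_per e S S = extremal_per (side A S true) (side A S false) <->
    exists x y, dominating_pair e A S x y;
  lap_perD1_ge : forall x, x \in S -> 10 * side A S (x \in A) <= lap_per e S (S :\ x) + 8;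
  lap_perD1_eq : forall x, x \in S ->
    lap_per e S (S :\ x) + 8 = 10 * side A S (x \in A) <-> exists y, dominating_pair e A S x y;
  lap_perD2_ge : forall x y, x \in S -> y \in S -> (x \in A) != (y \in A) ->
    5 <= lap_per e S (S :\ x :\ y);
  lap_perD2_eq : forall x y, x \in S -> y \in S -> (x \in A) != (y \in A) ->
    lap_per e S (S :\ x :\ y) = 5 <-> dominating_pair e A S x y }.

Lemma regular_sides (V : finType) (e : rel V) (A S : {set V}) :
  two_colored e A -> {in S, forall x, sub_degree e S x = 2} ->
  forall b, side A S b = side A S true.
Proof.
move=> eA d2; have H : side A S true = side A S false.
  have E b : \sum_(x in S | (x \in A) == b) sub_degree e S x = side A S b * 2.
    rewrite (eq_bigr (fun=> 2)) => [|x /andP[/d2]//].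
    rewrite -sum_nat_const; apply: eq_bigl => x; by rewrite !inE.
  have Et : \sum_(x in S | x \in A) sub_degree e S x = side A S true * 2.
    by rewrite -(E true); apply: eq_bigl => x; rewrite eqb_id.
  have Ef : \sum_(x in S | x \notin A) sub_degree e S x = side A S false * 2.
    by rewrite -(E false); apply: eq_bigl => x; rewrite eqbF_neg.
  by have := handshake_sides S eA; rewrite Et Ef; lia.
by case.
Qed.

(** Lets exponential products of degrees beat the quadratic [extremal_per]. *)
Lemma square_le_exp4 m : (m + 1) * (m + 1) <= 4 ^ m.
Proof. by elim: m => // m IH; rewrite expnS; nia. Qed.

(** A vertex of degree 2 cannot dominate a side of three or more vertices, so every equality clause
    amounts to a strict inequality. *)
Lemma regular_bounds_large (V : finType) (e : rel V) (A S : {set V}) :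
  two_colored e A -> S != set0 -> {in S, forall x, sub_degree e S x = 2} ->
  3 <= side A S true -> lap_per_bounds e A S.
Proof.
move=> eA S0 d2 k3; have kE := regular_sides eA d2.
have cS : #|S| = 2 * side A S true by rewrite (card_sides A S true) (kE (~~ _)); lia.
have nodom x : x \in S -> ~ dominating e A S x.
  by move=> xS /(dominating_degree S x eA); rewrite d2 // kE => E; rewrite -E in k3.
have nopair x y : ~ dominating_pair e A S x y by case=> xS _ _ /(nodom x xS).
have lb (T : {set V}) : T \subset S -> 2 ^ #|T| <= lap_per e S T.
  by move=> /subsetP TS; apply: leq_lap_per_prod => x /TS /d2 ->.
have sD (T : {set V}) x : T \subset S -> T :\ x \subset S.
  by move=> TS; apply: subset_trans (subD1set _ _) TS.
(* With sides of size [m + 3], the power of 2 for [S] with few vertices removed is [4 ^ m] times a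
   constant. *)
have [m km] : exists m, side A S true = m + 3 by exists (side A S true - 3); lia.
have m4 := square_le_exp4 m.
have pow j : 2 ^ (2 * m + j) = 4 ^ m * 2 ^ j by rewrite expnD expnM.
have cD1 x : x \in S -> #|S :\ x| = 2 * m + 5.
  by move=> xS; have := cardsD1 x S; rewrite xS; lia.
have cD2 x y : x \in S -> y \in S -> y != x -> #|S :\ x :\ y| = 2 * m + 4.
  by move=> xS yS yx; have := cardsD1 y (S :\ x); rewrite cD1 // !inE yx yS; lia.
have nbr2 x : x \in S -> exists y z,
    [/\ y \in S, z \in S, y != z, e x y & e x z] /\ forall t, t \in S -> e x t = (t == y) || (t == z).
  move=> xS; have /eqP/cards2P[y [z [yz /setP E]]] := d2 x xS; exists y, z.
  have := E y; have := E z; rewrite !inE !eqxx !orbT /= => /andP[-> ->] /andP[-> ->].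
  by split=> // t tS; have := E t; rewrite !inE tS.
have neq x y : e x y -> y != x.
  by apply: contraTneq => ->; rewrite (two_colored_irr eA).
have D1 x : x \in S -> 32 * 4 ^ m <= lap_per e S (S :\ x).
  by move=> xS; have := lb _ (sD _ x (subxx S)); rewrite cD1 // pow mulnC.
have D2 x y : x \in S -> y \in S -> y != x -> 16 * 4 ^ m <= lap_per e S (S :\ x :\ y).
  by move=> xS yS yx; have := lb _ (sD _ y (sD _ x (subxx S))); rewrite cD2 // pow mulnC.
have strict : extremal_per (side A S true) (side A S false) < lap_per e S S.
  have /set0Pn[x xS] := S0; have [y [z [[yS zS yz xy xz] nx]]] := nbr2 x xS.
  have yx := neq _ _ xy; have zx := neq _ _ xz.
  have R1 := lap_per_row_ge S eA xS.
  (* The diagonal product [64 * 4 ^ m] falls short of 104 at [m = 0]. Adding the swap of [y] with a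
     neighbour [t] other than [x], and the swaps of [x] with [y] and with [z], gives
     [2 * 40 * 4 ^ m + 2 * 16 * 4 ^ m], that is [112 * 4 ^ m]. *)
  have R2 : 2 * (16 * 4 ^ m) + 8 * 4 ^ m <= lap_per e S (S :\ x).
    have yT : y \in S :\ x by rewrite !inE yx.
    apply: leq_trans (lap_per_row_ge S eA yT); rewrite d2 //.
    apply: leq_add; first by rewrite leq_mul2l D2.
    have [t [tS tx yt]] : exists t, [/\ t \in S, t != x & e y t].
      have [t [t' [[tS tS' tt' yt yt'] _]]] := nbr2 y yS.
      have [tx|] := eqVneq t x; last by exists t.
      by exists t'; split=> //; rewrite -tx eq_sym.
    have ty := neq _ _ yt.
    rewrite (bigD1 t) /=; last by rewrite !inE tx tS.
    apply: leq_trans (leq_addr _ _).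
    have := lb _ (sD _ t (sD _ y (sD _ x (subxx S)))).
    have := cardsD1 t (S :\ x :\ y); rewrite cD2 // !inE ty tx tS => E.
    have -> : #|S :\ x :\ y :\ t| = 2 * m + 3 by clear -E; lia.
    by rewrite pow mulnC.
  move: R1; rewrite d2 // (bigD1 y) /=; last by rewrite yS.
  rewrite (bigD1 z) /=; last by rewrite zS xz eq_sym.
  have := D2 x y xS yS yx; have := D2 x z xS zS zx.
  rewrite /extremal_per kE km; clear -m4 R2; nia.
split.
- by move=> b; rewrite kE ltnW.
- exact: ltnW.
- by split=> [E|[x [y /nopair]]//]; rewrite E ltnn in strict.
- by move=> x xS; rewrite kE km; have := D1 x xS; clear -m4; nia.
- move=> x xS; split=> [|[y /nopair]//]; rewrite kE km; have := D1 x xS; clear -m4; nia.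
- move=> x y xS yS xy; have yx : y != x by apply: contraNneq xy => ->.
  have := D2 x y xS yS yx; clear -m4; nia.
- move=> x y xS yS xy; have yx : y != x by apply: contraNneq xy => ->.
  split=> [|/nopair//]; have := D2 x y xS yS yx; clear -m4; nia.
Qed.

(** Two vertices on each side, all of degree 2, form a complete bipartite graph: every vertex
    dominates, and all bounds are attained. *)
Lemma regular_bounds_C4 (V : finType) (e : rel V) (A S : {set V}) :
  two_colored e A -> S != set0 -> {in S, forall x, sub_degree e S x = 2} ->
  side A S true = 2 -> lap_per_bounds e A S.
Proof.
move=> eA S0 d2 k2; have kE b : side A S b = 2 by rewrite (regular_sides eA d2).
have dom x : x \in S -> dominating e A S x.
  by move=> xS; apply/(dominating_degree S x eA); rewrite d2 ?kE.
have twin x : x \in S -> exists2 x', x != x' & [set z in S | (z \in A) == (x \in A)] = [set x; x'].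
  move=> xS; have /eqP/cards2P[a [b [ab E]]] := kE (x \in A).
  have : x \in [set a; b] by rewrite -E !inE xS eqxx.
  rewrite !inE => /orP[]/eqP xE.
    by exists b; [rewrite xE | rewrite E xE].
  by exists a; [rewrite xE eq_sym | rewrite E xE setUC].
have vals x y : x \in S -> y \in S -> (x \in A) != (y \in A) ->
    [/\ lap_per e S S = 36, lap_per e S (S :\ x) = 12 & lap_per e S (S :\ x :\ y) = 5].
  move=> xS yS xy; have [x' xx' /setP Ex] := twin x xS; have [y' yy' /setP Ey] := twin y yS.
  have := Ex x'; rewrite !inE eqxx orbT => /andP[x'S cx].
  have := Ey y'; rewrite !inE eqxx orbT => /andP[y'S cy].
  have SE : S = [set x; x'; y; y'].
    apply/setP => z; have := Ex z; have := Ey z; rewrite !inE.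
    have [zS|zS] /= := boolP (z \in S).
      by rewrite -orbA => <- <-; move: xy; case: (z \in A); case: (x \in A); case: (y \in A).
    by rewrite -orbA => <- <-.
  have := @lap_per_C4 _ e A x x' y y' eA; rewrite /= -SE; apply.
    by rewrite xx' yy' cx cy.
  by rewrite !dom // ?(eqP cx) ?(eqP cy) // eq_sym.
have opp x : x \in S -> exists2 y, y \in S & (x \in A) != (y \in A).
  move=> xS; have : 0 < sub_degree e S x by rewrite d2.
  by rewrite card_gt0 => /set0Pn[y]; rewrite inE => /andP[yS /eA.2]; exists y.
have pair x y : x \in S -> y \in S -> (x \in A) != (y \in A) -> dominating_pair e A S x y.
  by move=> xS yS xy; split=> //; apply: dom.
split.
- by move=> b; rewrite kE.
- have /set0Pn[x xS] := S0; have [y yS xy] := opp x xS.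
  by have [-> _ _] := vals x y xS yS xy; rewrite !kE.
- have /set0Pn[x xS] := S0; have [y yS xy] := opp x xS.
  have [-> _ _] := vals x y xS yS xy; rewrite !kE; split=> // _.
  by exists x, y; apply: pair.
- by move=> x xS; have [y yS xy] := opp x xS; have [_ -> _] := vals x y xS yS xy; rewrite kE.
- move=> x xS; have [y yS xy] := opp x xS; have [_ -> _] := vals x y xS yS xy.
  by rewrite kE; split=> // _; exists y; apply: pair.
- by move=> x y xS yS xy; have [_ _ ->] := vals x y xS yS xy.
- by move=> x y xS yS xy; have [_ _ ->] := vals x y xS yS xy; split=> // _; apply: pair.
Qed.

Lemma regular_bounds (V : finType) (e : rel V) (A S : {set V}) :
  two_colored e A -> S != set0 -> {in S, forall x, sub_degree e S x = 2} ->
  lap_per_bounds e A S.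
Proof.
move=> eA S0 d2; have /set0Pn[x xS] := S0.
have := degree_le_side S x eA; rewrite d2 // (regular_sides eA d2) leq_eqVlt.
by case/predU1P=> [/esym|]; [apply: regular_bounds_C4 | apply: regular_bounds_large].
Qed.

(** * The induction on leaves *)

Lemma dominating_pairC (V : finType) (e : rel V) (A S : {set V}) (x y : V) :
  dominating_pair e A S x y -> dominating_pair e A S y x.
Proof. by case=> *; split; rewrite // eq_sym. Qed.

(** A leaf cannot dominate two or more vertices, so [u] is not in the pair. The member opposite to
    [u] must be adjacent to [u], hence is [w]; conversely, only that member has to reach [u]. *)
Lemma dominating_pair_leaf (V : finType) (e : rel V) (A S : {set V}) (u w x y : V) :
  two_colored e A -> leaf e S u w -> 2 <= side A S (~~ (u \in A)) ->
  dominating_pair e A S x y <->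
  dominating_pair e A (S :\ u) x y /\ (x = w \/ y = w).
Proof.
move=> eA lf s2; have [uS wS uw uz] := lf; have eC := eA.1.
have sub a : dominating e A S a -> dominating e A (S :\ u) a.
  by move=> da z /setD1P[_]; apply: da.
have neu a : dominating e A S a -> a != u.
  by apply: contraPneq => -> /(dominating_degree S u eA) E; rewrite -E (leaf_degree lf) in s2.
have opp a : a \in S -> dominating e A S a -> (u \in A) != (a \in A) -> a = w.
  by move=> aS da ua; apply: uz => //; rewrite eC; apply: da.
split=> [[xS yS xy dx dy]|[[/setD1P[xu xS] /setD1P[yu yS] xy dx dy] xyw]].
  split; first by split; rewrite ?inE ?neu //; apply: sub.
  have [ux|ux] := boolP ((u \in A) == (x \in A)); last by left; apply: opp.
  by right; apply: opp => //; rewrite (eqP ux).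
have uwA := eA.2 _ _ uw.
split=> // z zS za; have [zu|zu] := eqVneq z u.
- rewrite zu in za *; case: xyw => E; first by rewrite E eC.
  by move: xy za uwA; rewrite E; case: (x \in A); case: (w \in A); case: (u \in A).
- by apply: dx; rewrite // !inE zu.
- rewrite zu in za *; case: xyw => E; last by rewrite E eC.
  by move: xy za uwA; rewrite E; case: (y \in A); case: (w \in A); case: (u \in A).
- by apply: dy; rewrite // !inE zu.
Qed.

Lemma extremal_perC (p q : nat) : extremal_per p q = extremal_per q p.
Proof. by rewrite /extremal_per -!mulnA [p.-1 * _]mulnC [p + q]addnC. Qed.

(** The increment 20q - 16 is twice 10q - 8, the bound for deleting a vertex [w] on the side of size
    [q]. This makes the first bound pass exactly through the addition of a leaf. *)
Lemma extremal_perS (p q : nat) : 0 < p -> 0 < q ->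
  extremal_per p.+1 q + 16 = extremal_per p q + 20 * q.
Proof. by case: p q => [|p] [|q] // _ _; rewrite /extremal_per /=; lia. Qed.

Lemma leaf_bounds (V : finType) (e : rel V) (A S : {set V}) (u w : V) :
  two_colored e A -> unicyclic_on e S -> leaf e S u w ->
  lap_per_bounds e A (S :\ u) -> lap_per_bounds e A S.
Proof.
move=> eA uniS lf [s2 ge0 eq0 ge1 eq1 ge2 eq2].
have [uS wS uw uz] := lf; have wu := leaf_neq eA lf.
have uniH := unicyclic_on_delete_leaf eA lf uniS.
set H := S :\ u in s2 ge0 eq0 ge1 eq1 ge2 eq2 uniH *.
have wA : (w \in A) = ~~ (u \in A).
  by move: (eA.2 _ _ uw); case: (w \in A); case: (u \in A).
have uH : u \notin H by rewrite !inE eqxx.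
have wH : w \in H by rewrite !inE wu.
have inH x : x \in S -> x != u -> x \in H by rewrite !inE => -> ->.
have sC : side A S (u \in A) = (side A H (u \in A)).+1.
  by rewrite (sideD1 _ _ uS) eqxx addn1.
have sO : side A S (~~ (u \in A)) = side A H (~~ (u \in A)).
  by rewrite (sideD1 _ _ uS); case: (u \in A); rewrite addn0.
have pairE x y : dominating_pair e A S x y <-> dominating_pair e A H x y /\ (x = w \/ y = w).
  by apply: dominating_pair_leaf => //; rewrite sO.
(* By symmetry of [extremal_per], the side of [u] may be listed first whatever its colour. *)
have FE T : extremal_per (side A T true) (side A T false)
    = extremal_per (side A T (u \in A)) (side A T (~~ (u \in A))).
  by case: (u \in A) => //; rewrite extremal_perC.
have D1C (T : {set V}) x y : T :\ x :\ y = T :\ y :\ x by rewrite !setDDl setUC.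
have sD x : S :\ x \subset S by apply: subD1set.
have sDD x y : S :\ x :\ y \subset S by apply: subset_trans (subD1set _ _) (sD x).
have gt0 (T : {set V}) : T \subset H -> 0 < lap_per e H T by apply: lap_per_gt0.
have gtDD x y : 0 < lap_per e H (H :\ x :\ y).
  by apply: gt0; apply: subset_trans (subD1set _ _) (subD1set _ _).
have inL := lap_per_leaf_in eA lf; have outL := lap_per_leaf_out eA lf.
have p2 := s2 (u \in A); have q2 := s2 (~~ (u \in A)).
have w1 := ge1 w wH; have w1e := eq1 w wH; rewrite wA in w1 w1e.
have FS : extremal_per (side A S true) (side A S false) + 16 =
    extremal_per (side A H true) (side A H false) + 20 * side A H (~~ (u \in A)).
  by rewrite !FE sC sO; apply: extremal_perS; apply: ltnW.
(* The next facts reduce minors over [S] to minors over [H]. The extra term is doubled if [u] and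
   [w] are both kept, single if only [w] is kept, and absent if [w] is deleted. *)
have SS : lap_per e S S = lap_per e H H + 2 * lap_per e H (H :\ w).
  by rewrite inL // wS mul1n.
have SD x : x \in S -> x != u -> x != w ->
    lap_per e S (S :\ x) = lap_per e H (H :\ x) + 2 * lap_per e H (H :\ x :\ w).
  move=> xS xu xw; rewrite inL // ?inE ?uS ?wS ?(eq_sym u x) ?xu ?andbT //.
  by rewrite (eq_sym w x) xw mul1n (D1C S).
have SDw : lap_per e S (S :\ w) = lap_per e H (H :\ w).
  by rewrite inL // ?inE ?uS ?(eq_sym u w) ?wu // eqxx /= mul0n addn0 D1C.
have SDu : lap_per e S (S :\ u) = lap_per e H H + lap_per e H (H :\ w).
  by rewrite outL // wH mul1n.
have SDD x y : x \in S -> x != u -> y \in S -> y != u -> x != w -> y != w ->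
    lap_per e S (S :\ x :\ y)
    = lap_per e H (H :\ x :\ y) + 2 * lap_per e H (H :\ x :\ y :\ w).
  move=> xS xu yS yu xw yw.
  rewrite inL // ?inE ?uS ?wS ?(eq_sym u x) ?(eq_sym u y) ?xu ?yu //.
  by rewrite (eq_sym w x) (eq_sym w y) xw yw mul1n (D1C (S :\ x)) (D1C S x u).
have SDDw x : x \in S -> x != u -> x != w ->
    lap_per e S (S :\ x :\ w) = lap_per e H (H :\ x :\ w).
  move=> xS xu xw; rewrite inL // ?inE ?uS ?(eq_sym u x) ?(eq_sym u w) ?xu ?wu //.
  by rewrite eqxx /= mul0n addn0 (D1C (S :\ x)) (D1C S x u).
have SDDu y : y \in S -> y != u ->
    lap_per e H (H :\ y) <= lap_per e S (S :\ u :\ y).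
  by move=> yS yu; rewrite outL ?leq_addr // !inE eqxx andbF.
have big1 y : y \in H -> 12 <= lap_per e H (H :\ y).
  by move=> yH; have := ge1 y yH; have := s2 (y \in A); clear; lia.
(* The vertex on the side of [u] is named [x]. If [x] is [u], at least 12 = 10 * 2 - 8 remains; if
   [y] is [w], the value is the one for [H]; otherwise a positive term is added and the bound is
   strict. *)
have bd2 x y : x \in S -> y \in S -> (x \in A) = (u \in A) -> (x \in A) != (y \in A) ->
    5 <= lap_per e S (S :\ x :\ y)
    /\ (lap_per e S (S :\ x :\ y) = 5 <-> dominating_pair e A S x y).
  move=> xS yS xA xy.
  have yu : y != u by apply: contraNneq xy => ->; rewrite xA.
  have yH := inH y yS yu.
  have xw : x != w by apply: contra_eq_neq xA => ->; rewrite wA; case: (u \in A).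
  have [->|xu] := eqVneq x u.
    have := SDDu y yS yu; have := big1 y yH => b12 b.
    split; first by move: b12 b; clear; lia.
    split; first by move: b12 b; clear; lia.
    by case/pairE=> -[]; rewrite (negbTE uH).
  have xH := inH x xS xu.
  have [->|yw] := eqVneq y w.
    have xwA : (x \in A) != (w \in A) by rewrite xA wA; case: (u \in A).
    rewrite SDDw //; split; first exact: ge2.
    rewrite eq2 //; split=> [p|/pairE[] //].
    by apply/pairE; split=> //; right.
  have := ge2 x y xH yH xy.
  have : 0 < lap_per e H (H :\ x :\ y :\ w).
    by apply: gt0; apply: subset_trans (subD1set _ _) _; apply: subset_trans (subD1set _ _) (subD1set _ _).
  rewrite SDD // => g b; split; first by move: g b; clear; lia.
  split; first by move: g b; clear; lia.
  by case/pairE=> _ [E|E]; rewrite E eqxx in xw yw.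
have exw : (exists x y, dominating_pair e A S x y) <-> exists y, dominating_pair e A H w y.
  split=> [[x [y /pairE[p [E|E]]]]|[y p]].
  - by exists y; rewrite -E.
  - by exists x; apply: dominating_pairC; rewrite -E.
  - by exists w, y; apply/pairE; split=> //; left.
have bd1 x : x \in S -> 10 * side A S (x \in A) <= lap_per e S (S :\ x) + 8
    /\ (lap_per e S (S :\ x) + 8 = 10 * side A S (x \in A)
        <-> exists y, dominating_pair e A S x y).
  move=> xS; have [->|xu] := eqVneq x u.
    have lt : 10 * side A S (u \in A) < lap_per e S (S :\ u) + 8.
      rewrite SDu sC; move: ge0 w1 p2 q2; rewrite FE /extremal_per; clear; nia.
    split; first exact: ltnW.
    split=> [E|[y /pairE[[]]]]; first by rewrite E ltnn in lt.
    by rewrite (negbTE uH).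
  have xH := inH x xS xu.
  have [->|xw] := eqVneq x w.
    rewrite SDw wA sO; split=> //; rewrite w1e.
    split=> -[y p]; exists y; first by apply/pairE; split=> //; left.
    by case/pairE: p.
  have := ge1 x xH; have := eq1 x xH; rewrite SD //.
  (* On the side of [u] the bound rises by 10, twice the bound 5 for deleting [x] and [w] from [H].
     Equality makes both tight, and the second yields the pair [x], [w]. *)
  have [xA|xA] := eqVneq (x \in A) (u \in A).
    have xwA : (x \in A) != (w \in A) by rewrite xA wA; case: (u \in A).
    have := ge2 x w xH wH xwA; have := eq2 x w xH wH xwA.
    rewrite xA sC => e2 b2 e1 b1; split; first by move: b1 b2; clear; lia.
    split=> [E|[y /pairE[p [E|E]]]]; last 2 first.
    - by rewrite E eqxx in xw.
    - rewrite E in p; have E2 := e2.2 p; have E1 := e1.2 (ex_intro _ w p).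
      by move: E1 E2; clear; lia.
    - exists w; apply/pairE; split; last by right.
      by apply/e2; move: b1 b2 E; clear; lia.
  have xA' : (x \in A) = ~~ (u \in A) by move: xA; case: (x \in A); case: (u \in A).
  (* Opposite to [u] the bound stays the same while a positive term is added. A dominating pair of
     [S] with [x] would have to use [w], which is on the same side as [x]. *)
  have := gtDD x w; rewrite xA' sO => g _ b; split; first by move: b g; clear; lia.
  split; first by move: b g; clear; lia.
  case=> y /pairE[[_ _ xy _ _] [E|E]]; first by rewrite E eqxx in xw.
  by move: xy; rewrite E wA xA' eqxx.
have Fge : extremal_per (side A S true) (side A S false) <= lap_per e S S.
  by rewrite SS; move: FS ge0 w1; clear; lia.
split=> //.
- move=> b; have [->|] := eqVneq b (u \in A); first by rewrite sC ltnW.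
  by move=> bu; have -> : b = ~~ (u \in A) by [move: bu; case: b; case: (u \in A)]; rewrite sO.
(* Equality makes the bound for deleting [w] tight. Conversely, tightness there gives a dominating
   pair of [H], so the first bound for [H] is tight as well. *)
- rewrite exw -w1e SS; split=> [E|E1]; first by move: FS ge0 w1 E; clear; lia.
  have [y p] := w1e.1 E1; have E0 := eq0.2 (ex_intro _ w (ex_intro _ y p)).
  by move: FS E0 E1; clear; lia.
- by move=> x /bd1[].
- by move=> x /bd1[].
- move=> x y xS yS xy; have [xA|xA] := eqVneq (x \in A) (u \in A).
    by have [] := bd2 x y xS yS xA xy.
  have yA : (y \in A) = (u \in A).
    by move: xA xy; case: (x \in A); case: (u \in A); case: (y \in A).
  by rewrite D1C; have [] := bd2 y x yS xS yA; rewrite // eq_sym.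
- move=> x y xS yS xy; have [xA|xA] := eqVneq (x \in A) (u \in A).
    by have [] := bd2 x y xS yS xA xy.
  have yA : (y \in A) = (u \in A).
    by move: xA xy; case: (x \in A); case: (u \in A); case: (y \in A).
  have [|_ E] := bd2 y x yS xS yA; first by rewrite eq_sym.
  by rewrite D1C E; split=> /dominating_pairC.
Qed.

Lemma unicyclic_bounds (V : finType) (e : rel V) (A S : {set V}) :
  two_colored e A -> unicyclic_on e S -> lap_per_bounds e A S.
Proof.
move=> eA; have [n] := ubnP #|S|; elim: n S => // n IH S cS uniS.
have [/existsP[u /andP[uS /eqP du]]|no1] := boolP [exists u, (u \in S) && (sub_degree e S u == 1)].
  have [w lf] := degree1_leaf uS du.
  apply: (leaf_bounds eA uniS lf); apply: IH; last exact: (unicyclic_on_delete_leaf eA lf uniS).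
  by move: cS; rewrite (cardsD1 u S) uS.
have [S0 _ dS] := uniS.
have d2 x : x \in S -> 2 <= sub_degree e S x.
  move=> xS; have := unicyclic_on_degree_gt0 uniS xS.
  move: no1; rewrite negb_exists => /forallP/(_ x); rewrite xS /=.
  by case: (sub_degree e S x) => [|[|d]].
apply: regular_bounds => // x xS.
(* All degrees are at least 2 and their average is 2, so each excess over 2 vanishes. *)
move: dS; rewrite (eq_bigr (fun x => 2 + (sub_degree e S x - 2))) => [|y /d2 y2]; last first.
  by rewrite subnKC.
rewrite big_split /= sum_nat_const mulnC -[RHS]addn0 => /addnI /eqP.
rewrite sum_nat_eq0 => /forallP/(_ x); rewrite xS /= subn_eq0 => le2.
by apply/eqP; rewrite eqn_leq le2 d2.
Qed.

(** * Translation to the Laplacian and to edge counts *)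

Lemma per_laplacian (n : nat) (e : rel 'I_n) (A : {set 'I_n}) :
  two_colored e A -> per (laplacian e) = Posz (lap_per e [set: 'I_n] [set: 'I_n]).
Proof.
move=> eA; rewrite /per /lap_per /perm_sum (big_morph Posz PoszD (erefl _ : Posz 0 = 0%R)).
apply: eq_big => [s|s _]; first by apply/esym/subsetP => i _; rewrite inE.
pose eps i : int := ((-1) ^+ (i \in A))%R.
have eps2 i : (eps i * eps i)%R = 1%R by rewrite /eps -expr2 sqrr_sign.
(* A row sign and a column sign at every vertex have total product 1, so they may be inserted in
   each term; adjacent vertices have opposite signs, which turns the entries -1 into 1. *)
have epsP : (\prod_i eps i * \prod_i eps (s i))%R = 1%R.
  have -> : (\prod_i eps (s i) = \prod_i eps i)%R.
    by rewrite [RHS](reindex_inj (@perm_inj _ s)).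
  by rewrite -big_split big1 //= => i _; rewrite eps2.
transitivity (\prod_i (eps i * laplacian e i (s i) * eps (s i)))%R.
  by rewrite !big_split /= mulrAC epsP mul1r.
rewrite (big_morph Posz PoszM (erefl _ : Posz 1 = 1%R)).
apply: eq_big => [i|i _]; first by rewrite inE.
have dE j : sub_degree e [set: 'I_n] j = degree e j.
  by apply: eq_card => z; rewrite !inE.
rewrite mxE /signless; case: eqVneq => [<-|_].
  by rewrite (two_colored_irr eA) subr0 mul1r mulrAC eps2 mul1r dE natz.
rewrite mul0r sub0r mulrN mulNr; case ij : (e i (s i)); last by rewrite mulr0 mul0r oppr0.
by rewrite mulr1 /eps; have := eA.2 _ _ ij; case: (i \in A); case: (s i \in A).
Qed.

(** Every edge has exactly one end in [A], so edges correspond to ordered adjacent pairs whose first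
    member is in [A]. *)
Lemma card_edge_set (V : finType) (e : rel V) (A : {set V}) :
  two_colored e A -> #|edge_set e| = \sum_(x in A) sub_degree e [set: V] x.
Proof.
move=> [eC eA].
have -> : edge_set e = [set [set p.1; p.2] | p in [set p : V * V | (p.1 \in A) && e p.1 p.2]].
  apply/setP => E; rewrite inE; apply/existsP/imsetP => [[x /existsP[y /andP[xy /eqP->]]]|].
    have [xA|xA] := boolP (x \in A); first by exists (x, y); rewrite ?inE ?xA.
    exists (y, x); rewrite ?inE /= 1?setUC // eC xy andbT.
    by have := eA _ _ xy; rewrite (negbTE xA); case: (y \in A).
  by case=> -[x y]; rewrite inE /= => /andP[xA xy ->]; exists x; apply/existsP; exists y; rewrite xy eqxx.
rewrite card_in_imset => [|[x y] [x' y']]; last first.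
  rewrite !inE /= => /andP[xA xy] /andP[x'A x'y'] /setP E.
  have yA : y \notin A by have := eA _ _ xy; rewrite xA; case: (y \in A).
  have y'A : y' \notin A by have := eA _ _ x'y'; rewrite x'A; case: (y' \in A).
  have := E x; have := E y; rewrite !inE !eqxx orbT /= => /esym Ey /esym/orP[/eqP->|/eqP xy'].
    case/orP: Ey => /eqP yE; last by rewrite yE.
    by rewrite yE x'A in yA.
  by rewrite -xy' xA in y'A.
rewrite -sum1_card (eq_bigl (fun p => (p.1 \in A) && e p.1 p.2)) => [|p]; last by rewrite inE.
rewrite -(pair_big_dep (mem A) e (fun _ _ => 1)); apply: eq_bigr => x _.
by rewrite sum1_card; apply: eq_card => y; rewrite !inE.
Qed.

(** A set that no edge leaves is closed under [connect]. *)
Lemma cut_connected_setT (V : finType) (e : rel V) :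
  symmetric e -> graph_connected e -> cut_connected e [set: V].
Proof.
move=> eC con C /properP[_ [y _ yC]] /set0Pn[x xC].
have [/existsP[a /existsP[b /and3P[aC bC ab]]]|no] :=
    boolP [exists a, exists b, [&& a \in C, b \notin C & e a b]].
  by exists a, b; rewrite inE.
have stable a b : e a b -> a \in C -> b \in C.
  move=> ab aC; apply: contraNT no => bC.
  by apply/existsP; exists a; apply/existsP; exists b; rewrite aC bC.
have cl : closed e (mem C) by move=> a b ab; apply/idP/idP; apply: stable; rewrite // eC.
by move: yC; rewrite -(closed_connect cl (con x y)) xC.
Qed.

Lemma unicyclic_on_setT (V : finType) (e : rel V) (A : {set V}) :
  two_colored e A -> unicyclic e -> 0 < #|V| -> unicyclic_on e [set: V].
Proof.
move=> eA [[eC _] [con card]] V0; split.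
- by rewrite -card_gt0 cardsT.
- exact: cut_connected_setT.
- rewrite (bigID (mem A)) /= -(handshake_sides _ eA) cardsT -card (card_edge_set eA).
  by rewrite mul2n -addnn; congr (_ + _); apply: eq_bigl => x; rewrite inE.
Qed.

(** * Dominating pairs characterise B(p,q) *)

(** The pair is the preimage of v1 and v2, numbered 0 and 1. Every other vertex is adjacent to one
    of them, and the colouring decides to which. *)
Lemma dominating_pair_of_iso (p q : nat) (e : rel 'I_(p + q)) (A : {set 'I_(p + q)}) :
  1 < p -> 1 < q -> two_colored e A -> graph_iso e (Bgraph p q) ->
  exists x y, dominating_pair e A [set: _] x y.
Proof.
move=> p2 q2 eA [f fE].
have n0 : 0 < p + q by lia.
have n1 : 1 < p + q by lia.
pose x := (f^-1)%g (Ordinal n0); pose y := (f^-1)%g (Ordinal n1).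
have fx : f x = Ordinal n0 by rewrite permKV.
have fy : f y = Ordinal n1 by rewrite permKV.
have xy : e x y by rewrite fE fx fy.
have adj z : z != x -> z != y -> e x z || e y z.
  move=> zx zy; have : f z != f x by rewrite (inj_eq perm_inj).
  have : f z != f y by rewrite (inj_eq perm_inj).
  rewrite !fE fx fy /Bgraph /B_base -!val_eqE /=.
  by have := ltn_ord (f z); case: (val (f z)) => [|[|[|[|k]]]] //= kn _ _; lia.
exists x, y; have cxy := eA.2 _ _ xy; split; rewrite ?inE // => z _ cz.
- have zx : z != x by apply: contraNneq cz => ->.
  have [->//|zy] := eqVneq z y.
  case/orP: (adj z zx zy) => // /eA.2.
  by move: cz cxy; case: (x \in A); case: (y \in A); case: (z \in A).
- have zy : z != y by apply: contraNneq cz => ->.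
  have [->|zx] := eqVneq z x; first by rewrite eA.1.
  case/orP: (adj z zx zy) => // /eA.2.
  by move: cz cxy; case: (x \in A); case: (y \in A); case: (z \in A).
Qed.

(** Count edges by their ends in [A]: [y] accounts for the whole opposite side, and each other
    vertex of [A] for at least one edge, to [x]. The total leaves an excess of one, so a single
    vertex [c] has a second neighbour [d]. *)
Lemma dominating_pair_extra_edge (V : finType) (e : rel V) (A : {set V}) (x y : V) :
  two_colored e A -> #|edge_set e| = #|V| -> y \in A ->
  dominating_pair e A [set: V] x y ->
  exists c d, [/\ c \in A, c != y, d \notin A, d != x &
    forall i j, i \in A -> j \notin A -> e i j = [|| i == y, j == x | (i == c) && (j == d)]].
Proof.
move=> eA cE yA [_ _ cxy dx dy]; have eC := eA.1.
have xA : x \notin A by move: cxy; rewrite yA; case: (x \in A).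
have ex z : z \in A -> e x z by move=> zA; apply: dx; rewrite ?inE // zA (negbTE xA).
have ey z : z \notin A -> e y z by move=> zA; apply: dy; rewrite ?inE // yA (negbTE zA).
have degy : sub_degree e [set: V] y = #|~: A|.
  apply: eq_card => z; rewrite !inE /=.
  by apply/idP/idP => [/eA.2|/ey //]; rewrite yA; case: (z \in A).
have degA z : z \in A -> 1 <= sub_degree e [set: V] z.
  by move=> zA; rewrite card_gt0; apply/set0Pn; exists x; rewrite inE inE eC ex.
have : \sum_(z in A :\ y) (sub_degree e [set: V] z - 1) == 1.
  move: cE; rewrite (card_edge_set eA) (big_setD1 y) //= degy -(cardsC A) addnC => /addIn.
  rewrite (eq_bigr (fun z => 1 + (sub_degree e [set: V] z - 1))) => [|z /setD1P[_ /degA dz]]; last first.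
    by rewrite subnKC.
  rewrite big_split /= sum1_card => sumA; apply/eqP.
  by have := cardsD1 y A; move: sumA; rewrite yA; clear; lia.
case/sum_nat_eq1 => c [/setD1P[cy cinA] degc deg1].
have /eqP/cards2P[a [b [ab /setP E]]] : sub_degree e [set: V] c = 2 by move: degc; clear; lia.
have [d dx' Ec] : exists2 d, d != x & forall z, e c z = (z == x) || (z == d).
  have Ez z : e c z = (z == a) || (z == b) by have := E z; rewrite !inE.
  have := Ez x; rewrite eC ex // => /esym/orP[]/eqP xE.
    by exists b; rewrite ?xE // eq_sym.
  by exists a; rewrite xE // => z; rewrite orbC Ez.
have cd : e c d by rewrite Ec eqxx orbT.
exists c, d; split=> //.
  by move: (eA.2 _ _ cd); rewrite cinA; case: (d \in A).
move=> i j iA jA; have [->|iy] := eqVneq i y; first by rewrite ey.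
have [->|ic] := eqVneq i c; first by rewrite Ec.
have d1 : sub_degree e [set: V] i = 1.
  have : i \in A :\ y by rewrite !inE iy.
  by move=> /(deg1 i ic); have := degA i iA; clear; lia.
have [w [_ _ iw iwu]] := degree1_leaf (in_setT i) d1.
have wx : w = x by apply/esym/iwu; rewrite ?inE // eC ex.
rewrite orbF; apply/idP/eqP => [ij|->]; last by rewrite eC ex.
by rewrite -wx; apply: iwu; rewrite ?inE.
Qed.

Lemma iso_of_dominating_pair (p q : nat) (e : rel 'I_(p + q)) (A : {set 'I_(p + q)})
    (x y : 'I_(p + q)) :
  two_colored e A -> #|A| = p -> #|edge_set e| = #|'I_(p + q)| ->
  y \in A -> dominating_pair e A [set: _] x y -> graph_iso e (Bgraph p q).
Proof.
move=> eA cA cE yA dxy; have eC := eA.1.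
have [c [d [cinA cy dA dx' eE]]] := dominating_pair_extra_edge eA cE yA dxy.
have xA : x \notin A by have [_ _] := dxy; rewrite yA; case: (x \in A).
pose LA := enum (A :\ y :\ c); pose LB := enum (~: A :\ x :\ d).
(* The position in this list is the number in [Bgraph]: first the cycle x, y, d, c, then the p - 2
   other vertices of [A], pendant at [x], then the rest, pendant at [y]. *)
pose L := [:: x, y, d, c & LA ++ LB].
have neqA s t : s \in A -> t \notin A -> s != t.
  by move=> sA; apply: contraNneq => <-.
have yx : y != x by apply: neqA. have cx : c != x by apply: neqA.
have yd : y != d by apply: neqA. have cdn : c != d by apply: neqA.
have [xy xd xc] : [/\ x != y, x != d & x != c] by rewrite !(eq_sym x).
have [yc dc] : y != c /\ d != c by rewrite eq_sym cy eq_sym.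
have uL : uniq L.
  rewrite /= !inE !mem_cat !mem_enum !inE !negb_or !negb_and !negbK.
  rewrite xy xd xc yd yc dc xA dA yA cinA !eqxx ?orbT /= cat_uniq !enum_uniq andbT /=.
  apply/hasPn => z; rewrite !mem_enum !inE => /and3P[_ _ zA].
  by rewrite (negbTE zA) !andbF.
have [k kE pE] : exists2 k, size LA = k & p = k + 2.
  exists (size LA) => //; transitivity #|A| => //; rewrite /LA -cardE [RHS]addnC.
  by rewrite (cardsD1 y A) yA (cardsD1 c (A :\ y)) !inE cy cinA.
have mL z : z \in L.
  rewrite !inE mem_cat !mem_enum !inE.
  by case: (z == x); case: (z == y); case: (z == d); case: (z == c); case: (z \in A).
have szL : size L = p + q.
  rewrite -(card_uniqP uL) -[RHS]card_ord; apply: eq_card => z; exact: mL.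
have gl z : index z L < p + q by have := mL z; rewrite -index_mem szL.
pose g z : 'I_(p + q) := Ordinal (gl z).
have ginj : injective g.
  move=> s t /(congr1 val) E; have {}E : index s L = index t L by [].
  by rewrite -(nth_index x (mL s)) E nth_index ?mL.
(* Each test on numbers in [B_base] becomes a statement about [x], [y], [d], [c] and the sides. *)
have cls z : [/\ (index z L == 0) = (z == x), (index z L == 1) = (z == y),
    (index z L == 2) = (z == d) & (index z L == 3) = (z == c)] /\
    (4 <= index z L < p + 2) = [&& z \in A, z != y & z != c] /\
    (4 <= index z L) && (p + 2 <= index z L) = [&& z \notin A, z != x & z != d].
  rewrite /L /= ![_ == z]eq_sym.
  have [->|zx] := eqVneq z x.
    by rewrite (negbTE xy) (negbTE xd) (negbTE xc) (negbTE xA).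
  have [->|zy] := eqVneq z y.
    by rewrite (negbTE yd) (negbTE yc) yA !andbF.
  have [->|zd] := eqVneq z d.
    by rewrite (negbTE dc) (negbTE dA) !andbF.
  have [->|zc] := eqVneq z c; first by rewrite cinA !andbF.
  rewrite index_cat mem_enum !inE zc zy /= !andbT.
  have [zA|zA] := boolP (z \in A).
    have iLA : index z LA < k by rewrite -kE index_mem mem_enum !inE zc zy.
    by split=> //; move: pE iLA; clear; lia.
  by rewrite kE; split=> //; move: pE; clear; lia.
exists (perm ginj) => s t; rewrite /Bgraph /B_base !permE /=.
have [[s0 s1 s2 s3] [s4 s5]] := cls s; have [[t0 t1 t2 t3] [t4 t5]] := cls t.
rewrite -!andbA !(s0, s1, s2, s3, s4, s5) !(t0, t1, t2, t3, t4, t5).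
(* The consistent positions of a vertex; with them the comparison of adjacencies is a propositional
   check. *)
have cns z : [|| [&& z == x, z != y, z != d, z != c & z \notin A],
    [&& z != x, z == y, z != d, z != c & z \in A],
    [&& z != x, z != y, z == d, z != c & z \notin A],
    [&& z != x, z != y, z != d, z == c & z \in A]
    | [&& z != x, z != y, z != d & z != c]].
  have [->|zx] := eqVneq z x.
    by rewrite xy xd xc xA.
  have [->|zy] := eqVneq z y; first by rewrite yd yc yA.
  have [->|zd] := eqVneq z d; first by rewrite dc dA.
  by have [->|zc] := eqVneq z c; first by rewrite cinA.
have est : e s t = if s \in A
    then (t \notin A) && [|| s == y, t == x | (s == c) && (t == d)]
    else (t \in A) && [|| t == y, s == x | (t == c) && (s == d)].
  have [sinA|snA] := boolP (s \in A); have [tinA|tnA] /= := boolP (t \in A).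
  - by apply/negP => /eA.2; rewrite sinA tinA.
  - exact: eE.
  - by rewrite eC; apply: eE.
  - by apply/negP => /eA.2; rewrite (negbTE snA) (negbTE tnA).
rewrite est; move: (cns s) (cns t).
case: (s == x); case: (s == y); case: (s == d); case: (s == c); case: (s \in A) => //= _;
case: (t == x); case: (t == y); case: (t == d); case: (t == c); case: (t \in A) => //=.
Qed.

Local Open Scope ring_scope.

Theorem theorem3p7 (p q : nat) (e : rel 'I_(p + q)) :
  (0 < p)%N -> (p <= q)%N -> in_U p q e ->
  20%:Z * (p%:Z - 1) * (q%:Z - 1) + 4%:Z * (p + q)%N%:Z <= per (laplacian e)
  /\ (per (laplacian e) = 20%:Z * (p%:Z - 1) * (q%:Z - 1) + 4%:Z * (p + q)%N%:Z
      <-> graph_iso e (Bgraph p q)).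
Proof.
move=> p0 pq [uni [A [cA cAc eAc]]].
have eA : two_colored e A by split=> //; case: uni => [[]].
have V0 : (0 < #|'I_(p + q)|)%N by rewrite card_ord addn_gt0 p0.
have [s2 ge0 eq0 _ _ _ _] := unicyclic_bounds eA (unicyclic_on_setT eA uni V0).
have sT : side A [set: _] true = p.
  by rewrite -[RHS]cA; apply: eq_card => z; rewrite !inE eqb_id.
have sF : side A [set: _] false = q.
  by rewrite -[RHS]cAc; apply: eq_card => z; rewrite !inE eqbF_neg.
have p2 := s2 true; have q2 := s2 false.
rewrite sT in p2; rewrite sF in q2; rewrite sT sF in ge0 eq0.
(* Positive [p] and [q] make the integer differences agree with the predecessors. *)
have -> : 20%:Z * (p%:Z - 1) * (q%:Z - 1) + 4%:Z * (p + q)%N%:Z = Posz (extremal_per p q).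
  by rewrite /extremal_per; move: p0 q2; clear; case: p q => [|p] [|q] //= _ _; lia.
rewrite (per_laplacian eA); split=> //; split=> [[/eq0[x [y dxy]]]|/(dominating_pair_of_iso p2 q2 eA)].
  have cE : #|edge_set e| = #|'I_(p + q)| by case: uni => _ [].
  (* The member of the pair in [A], the side of size [p], has to play v2, since v1 carries the
     pendant vertices from that side. *)
  have [yA|yA] := boolP (y \in A); first exact: iso_of_dominating_pair dxy.
  have xA : x \in A by have [_ _] := dxy; rewrite (negbTE yA); case: (x \in A).
  exact: iso_of_dominating_pair (dominating_pairC dxy).
by move=> dxy; congr Posz; apply/eq0.
Qed.
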